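(* Let $d\ge 2$, $\omega=e^{2\pi i/d}$, $M$ the $d\times d$ diagonal matrix with diagonal entries $1,\omega,\dots,\omega^{d-1}$, and $\mathcal G=\{\pm I,\pm M,\dots,\pm M^{d-1}\}$. Let $\vec T=(\vec T_1,\vec T_2)$ be a $2k$-tuple of edges of $\vec G$. (a) If $\vec T$ satisfies Condition 1 at every vertex of $H$, then $\mathrm{tr}(\mathcal Q(\vec T_1))\,\mathrm{tr}(\mathcal Q(\vec T_2))=d^2$. (b) If $\vec T$ satisfies Condition 1, 2 or 3 at every vertex of $H$ but not Condition 1 at every vertex, then $0<E\big(\mathrm{tr}(\mathcal Q(\vec T_1))\,\mathrm{tr}(\mathcal Q(\vec T_2))\big)\le d$. (c) Otherwise, $E\big(\mathrm{tr}(\mathcal Q(\vec T_1))\,\mathrm{tr}(\mathcal Q(\vec T_2))\big)=0$.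
   Context: $H$ is a connected finite simple graph with no leaves, vertices $1,\dots,t$, $k$ edges, oriented arbitrarily as $\vec H$ with directed edges $\overrightarrow{a_1a_2},\dots,\overrightarrow{a_{2k-1}a_{2k}}$. $\Gamma(b)=\{i:a_i=b\}$; a distinguished index $\iota(b)\in\Gamma(b)$ is fixed. $G$ is a finite simple graph; $\vec G$ replaces each edge $vw$ by $\overrightarrow{vw},\overrightarrow{wv}$. Hash functions $\mathcal X_i:V(G)\to\mathcal G$ ($1\le i\le 2k$): non-distinguished ones chosen independently and uniformly from a $4k$-wise independent family with uniform values; for $i=\iota(b)$, $\mathcal X_i(v)=\prod_{j\in\Gamma(b),j\ne i}\mathcal X_j(v)^{-1}$ ($=I$ if $\Gamma(b)=\{i\}$). Write $\vec T_1=(\overrightarrow{v_1v_2},\dots,\overrightarrow{v_{2k-1}v_{2k}})$, $\vec T_2=(\overrightarrow{w_1w_2},\dots,\overrightarrow{w_{2k-1}w_{2k}})$; $\mathcal Q(\vec T_1)=\prod_{j=1}^{2k}\mathcal X_j(v_j)$, $\mathcal Q(\vec T_2)=\prod_{j=1}^{2k}\mathcal X_j(w_j)$. Conditions at $b$: Condition 1: the $v_i$, $i\in\Gamma(b)$, are all equal and the $w_i$, $i\in\Gamma(b)$, are all equal. Condition 2: $v_i=w_i$ for all $i\in\Gamma(b)$. Condition 3: there are vertices $x,y$ of $G$ such that for every $i\in\Gamma(b)$, either ($v_i=x$, $w_i=y$) or ($v_i=y$, $w_i=x$). *)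

(* Defs.v *)
From mathcomp Require Import all_boot all_order all_algebra.
From mathcomp Require Import complex.
From mathcomp Require Import reals sequences exp trigo.

Set Implicit Arguments.
Unset Strict Implicit.
Unset Printing Implicit Defensive.

Import Order.TTheory GRing.Theory Num.Theory.
Local Open Scope ring_scope.
Local Open Scope complex_scope.

(* As the relation e is symmetric, the pairs (x, y) with e x y are
   exactly the directed edges of the graph in which every edge is replaced
   by its two orientations. *)

Definition simple_graph (T : finType) (e : rel T) : Prop :=
  symmetric e /\ irreflexive e.

Definition connected_graph (T : finType) (e : rel T) : Prop :=
  (0 < #|T|)%N /\ forall x y : T, connect e x y.

Definition no_leaves (T : finType) (e : rel T) : Prop :=
  forall x : T, #|[set y | e x y]| <> 1%N.

Lemma tail_subproof (k : nat) (j : 'I_k) : (2 * j < 2 * k)%N.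
Proof. by rewrite ltn_mul2l ltn_ord. Qed.

Lemma head_subproof (k : nat) (j : 'I_k) : ((2 * j).+1 < 2 * k)%N.
Proof. by rewrite !mul2n -doubleS leq_double ltn_ord. Qed.

(* k directed edges are given by the sequence of their 2k endpoints: with
   indices starting from 0, the j-th edge goes from the endpoint of index 2j
   to the endpoint of index 2j+1. *)

Definition tail_ix (k : nat) (j : 'I_k) : 'I_(2 * k) :=
  Ordinal (tail_subproof j).

Definition head_ix (k : nat) (j : 'I_k) : 'I_(2 * k) :=
  Ordinal (head_subproof j).

Definition edge_tuple (T : finType) (e : rel T) (k : nat)
    (v : 'I_(2 * k) -> T) : Prop :=
  forall j : 'I_k, e (v (tail_ix j)) (v (head_ix j)).

(* Every edge occurs exactly once, in one of its two directions; hence the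
   graph has exactly k edges. *)
Definition orientation (T : finType) (e : rel T) (k : nat)
    (a : 'I_(2 * k) -> T) : Prop :=
  edge_tuple e a /\
  forall x y : T, e x y -> exists! j : 'I_k,
    (a (tail_ix j) = x /\ a (head_ix j) = y) \/
    (a (tail_ix j) = y /\ a (head_ix j) = x).

Definition Gamma (t k : nat) (a : 'I_(2 * k) -> 'I_t) (b : 'I_t) :
    {set 'I_(2 * k)} :=
  [set i | a i == b].

Definition condition1 (t k : nat) (a : 'I_(2 * k) -> 'I_t) (V : finType)
    (v w : 'I_(2 * k) -> V) (b : 'I_t) : Prop :=
  (forall i j, i \in Gamma a b -> j \in Gamma a b -> v i = v j) /\
  (forall i j, i \in Gamma a b -> j \in Gamma a b -> w i = w j).

Definition condition2 (t k : nat) (a : 'I_(2 * k) -> 'I_t) (V : finType)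
    (v w : 'I_(2 * k) -> V) (b : 'I_t) : Prop :=
  forall i, i \in Gamma a b -> v i = w i.

Definition condition3 (t k : nat) (a : 'I_(2 * k) -> 'I_t) (V : finType)
    (v w : 'I_(2 * k) -> V) (b : 'I_t) : Prop :=
  exists x y : V, forall i, i \in Gamma a b ->
    (v i = x /\ w i = y) \/ (v i = y /\ w i = x).

(* h c is the member of index c of a finite family of functions
   from V to A (repetitions are allowed), and c is drawn uniformly. *)

Definition unif_pr (I : finType) (P : pred I) : rat := #|P|%:R / #|I|%:R.

Definition uniform_values (I V A : finType) (h : I -> V -> A) : Prop :=
  forall (v : V) (g : A), unif_pr [pred c | h c v == g] = 1 / #|A|%:R.

(* The values at any at most m distinct points are mutually independent. *)
Definition wise_independent (m : nat) (I V A : finType) (h : I -> V -> A) :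
    Prop :=
  forall (S : {set V}) (g : V -> A), (#|S| <= m)%N ->
    unif_pr [pred c | [forall x in S, h c x == g x]] =
    \prod_(x in S) unif_pr [pred c | h c x == g x].

Definition cexp (R : realType) (z : R[i]) : R[i] :=
  let: x +i* y := z in (expR x)%:C * (cos y +i* sin y).

Definition omega (R : realType) (d : nat) : R[i] :=
  cexp (2%:R * pi%:C * 'i / d%:R).

Definition clockM (R : realType) (d : nat) : 'M[R[i]]_d :=
  diag_mx (\row_j omega R d ^+ j).

Definition calG_seq (R : realType) (d : nat) : seq 'M[R[i]]_d :=
  [seq clockM R d ^+ j | j <- iota 0 d] ++
  [seq - clockM R d ^+ j | j <- iota 0 d].

(* The set underlying the list: repetitions do not count in its cardinal. *)
Definition calG (R : realType) (d : nat) : finType := seq_sub (calG_seq R d).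

Definition matG (R : realType) (d : nat) (g : calG R d) : 'M[R[i]]_d := val g.

(* An outcome chooses, for each non-distinguished index, a member of the hash
   family; the uniform measure on outcomes makes these choices independent and
   uniform. dst b is the distinguished index of the vertex b. *)

Definition nondist (t k : nat) (a : 'I_(2 * k) -> 'I_t)
    (dst : 'I_t -> 'I_(2 * k)) : finType :=
  {i : 'I_(2 * k) | i != dst (a i)}.

Definition outcome (t k : nat) (a : 'I_(2 * k) -> 'I_t)
    (dst : 'I_t -> 'I_(2 * k)) (I : finType) : finType :=
  {ffun nondist a dst -> I}.

(* At the distinguished index of b, the product ranges over the other indices
   of Gamma b; it is the identity matrix if there is none. *)
Definition hashX (R : realType) (d t k : nat) (a : 'I_(2 * k) -> 'I_t)
    (dst : 'I_t -> 'I_(2 * k)) (I V : finType) (h : I -> V -> calG R d)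
    (s : outcome a dst I) (i : 'I_(2 * k)) (x : V) : 'M[R[i]]_d :=
  match insub i : option (nondist a dst) with
  | Some j => matG (h (s j) x)
  | None => \prod_(j : nondist a dst | val j \in Gamma a (a i))
              invmx (matG (h (s j) x))
  end.

Definition calQ (R : realType) (d t k : nat) (a : 'I_(2 * k) -> 'I_t)
    (dst : 'I_t -> 'I_(2 * k)) (I V : finType) (h : I -> V -> calG R d)
    (v : 'I_(2 * k) -> V) (s : outcome a dst I) : 'M[R[i]]_d :=
  \prod_(j < 2 * k) hashX h s j (v j).

Definition expectation (R : realType) (O : finType) (f : O -> R[i]) : R[i] :=
  (\sum_(s : O) f s) / #|O|%:R.

(* Main.v *)
Require Import Defs.
From mathcomp Require Import all_boot all_order all_algebra.
From mathcomp Require Import complex.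
From mathcomp Require Import reals sequences exp trigo.

Import Order.TTheory GRing.Theory Num.Theory.
Local Open Scope ring_scope.
Local Open Scope complex_scope.

(* The diagonal entries chi_p of the matrices in G are characters, and the
   trace is their sum, so the expectation is a sum over pairs (p, q) of
   expectations of products of characters. Writing i = iota(b) for the
   distinguished index of the vertex b = a_j, these factor over the
   non-distinguished indices j into the means of
     chi_p(X_j(v_j)) chi_p(X_j(v_i))^-1 chi_q(X_j(w_j)) chi_q(X_j(w_i))^-1.
   At most four points of V(G) are involved, so by independence and
   orthogonality of characters each mean is 1 if the character attached to
   every point is trivial, and 0 otherwise. As -I has character value -1, each
   point must occur an even number of times, which leaves three cases:
   v_j = v_i, w_j = w_i; or v_j = w_j, v_i = w_i and chi_p chi_q = 1; or
   v_j = w_i, v_i = w_j and chi_p = chi_q. Hence the expectation counts pairs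
   (p, q); the pair (0, 0) always qualifies when each j falls in one of the
   three cases, and once some j is not of the first kind, p determines q. *)

(** * Character sums and means over a wise independent family *)

Lemma sum_twisted_eq0 (F : fieldType) (A : finType) (f : A -> F)
    (tau : A -> A) (z : F) :
  injective tau -> (forall g, f (tau g) = z * f g) -> z != 1 ->
  \sum_g f g = 0.
Proof.
move=> tau_inj f_tau z_neq1.
(* An injective self-map of a finite type is bijective, so reindexing along [tau] multiplies the sum
   by [z]. *)
have : \sum_g f g = z * \sum_g f g.
  rewrite mulr_sumr [LHS](reindex_inj tau_inj).
  by apply: eq_bigr => g _; rewrite f_tau.
move/eqP; rewrite -subr_eq0 -{1}[\sum_g f g]mul1r -mulrBl mulf_eq0 subr_eq0.
by rewrite eq_sym (negbTE z_neq1) => /eqP.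
Qed.

Lemma prod_at (F : comNzRingType) (V : finType) (S : {set V}) (y : V)
    (f : V -> F) :
  y \in S -> \prod_(x in S) (if x == y then f x else 1) = f y.
Proof.
move=> yS; rewrite -big_mkcondr (big_pred1 y) // => x.
by rewrite /= andb_idl // => /eqP ->.
Qed.

(** By uniformity each point of [S] contributes a factor 1/[#|A|]; clearing denominators gives an
    identity in [nat], which can be cast into any field. *)
Lemma card_wise_independent (m : nat) (I V A : finType) (h : I -> V -> A)
    (S : {set V}) (g : V -> A) :
  uniform_values h -> wise_independent m h -> (0 < #|I|)%N ->
  (0 < #|A|)%N -> (#|S| <= m)%N ->
  (#|[pred c | [forall x in S, h c x == g x]]| * #|A| ^ #|S|)%N = #|I|.
Proof.
move=> hU hI I_gt0 A_gt0 S_le.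
have := hI S g S_le; under eq_bigr => x _ do rewrite hU.
rewrite prodr_const expr_div_n expr1n /unif_pr => /eqP.
have I_neq0 : #|I|%:R != 0 :> rat by rewrite pnatr_eq0 -lt0n.
have A_neq0 : #|A|%:R ^+ #|S| != 0 :> rat.
  by rewrite expf_neq0 // pnatr_eq0 -lt0n.
by rewrite eqr_div // mul1r -natrX -natrM eqr_nat => /eqP.
Qed.

Lemma wise_independent_mean (F : numFieldType) (m : nat) (I V A : finType)
    (h : I -> V -> A) (S : {set V}) (f : V -> A -> F) :
  uniform_values h -> wise_independent m h -> (0 < #|I|)%N ->
  (#|S| <= m)%N ->
  (\sum_c \prod_(x in S) f x (h c x)) / #|I|%:R =
  \prod_(x in S) ((\sum_g f x g) / #|A|%:R).
Proof.
move=> hU hI I_gt0 S_le.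
have [c0 _] := card_gt0P I_gt0.
(* With [S] empty there may be no default value [g0] in [A]; both sides are then 1. *)
have [S0|/set0Pn[x0 x0S]] := eqVneq S set0.
  rewrite S0 !big_set0; under eq_bigr => c _ do rewrite big_set0.
  by rewrite sumr_const divff // pnatr_eq0 -lt0n.
pose g0 := h c0 x0.
have A_gt0 : (0 < #|A|)%N by apply/card_gt0P; exists g0.
(* [res c] restricts [h c] to [S], with default [g0] outside, to match the functions indexing the
   expanded product of sums; all fibres of [res] over these have the same size. *)
pose res c := [ffun x => if x \in S then h c x else g0].
rewrite big_split /= prodr_const (big_distr_big_dep g0) /=.
rewrite (partition_big res (mem (pfamily g0 (mem S) (fun _ => predT)))) /=;
  last first.
  move=> c _; apply/pfamilyP; split=> //.
  by apply/subsetP => x; rewrite inE ffunE; case: ifP; rewrite ?eqxx.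
rewrite mulr_suml [RHS]mulr_suml; apply: eq_bigr => g /pfamilyP[gS _].
have res_eq c : (res c == g) = [forall x in S, h c x == g x].
  apply/eqP/forall_inP => [<- x xS|eq_hg]; first by rewrite ffunE xS.
  apply/ffunP => x; rewrite ffunE; case: ifP => [xS|xS].
    exact/eqP/eq_hg.
  by apply/esym/eqP; apply: contraFT xS => gx; apply: (subsetP gS); rewrite inE.
rewrite (eq_bigr (fun=> \prod_(x in S) f x (g x))); last first.
  move=> c; rewrite res_eq => /forall_inP eq_hg.
  by apply: eq_bigr => x xS; rewrite (eqP (eq_hg x xS)).
rewrite (eq_bigl _ _ res_eq) sumr_const -[X in X / _]mulr_natr -mulrA.
congr (_ * _).
have N_A := card_wise_independent m I V A h S g hU hI I_gt0 A_gt0 S_le.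
rewrite -N_A natrM invfM natrX exprVn mulrA divff ?mul1r // pnatr_eq0.
by apply: contraTneq I_gt0 => N0; rewrite -N_A [X in (X * _)%N]N0 mul0n.
Qed.

(** * Diagonal matrices and the root of unity [omega] *)

Lemma prod_diag_mx (F : comNzRingType) (n : nat) (J : Type) (r : seq J)
    (P : pred J) (D : J -> 'rV[F]_n) :
  \prod_(j <- r | P j) diag_mx (D j) =
  diag_mx (\row_p \prod_(j <- r | P j) D j 0 p).
Proof.
elim: r => [|j r IHr].
  by rewrite big_nil; apply/matrixP => p q; rewrite !mxE big_nil.
rewrite big_cons IHr; case: ifP => Pj; last first.
  by congr diag_mx; apply/rowP => p; rewrite !mxE big_cons Pj.
rewrite [_ * _]mulmx_diag; congr diag_mx.
by apply/rowP => p; rewrite !mxE big_cons Pj.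
Qed.

Lemma invmx_diag (F : fieldType) (n : nat) (D : 'rV[F]_n) :
  (forall p, D 0 p != 0) -> invmx (diag_mx D) = diag_mx (\row_p (D 0 p)^-1).
Proof.
move=> D_neq0.
have DE : diag_mx D *m diag_mx (\row_p (D 0 p)^-1) = 1%:M.
  rewrite mulmx_diag -diag_const_mx; congr diag_mx.
  by apply/rowP => p; rewrite !mxE divff.
have [D_unit _] := mulmx1_unit DE.
by rewrite -[RHS](mulKmx D_unit) DE mulmx1.
Qed.

(** The angle is written as twice [y] because for 0 < m < d the half angle [y] lies strictly between
    0 and pi, where the sine is positive. *)
Lemma omegaX (R : realType) (d m : nat) :
  let y := pi * m%:R / d%:R : R in
  omega R d ^+ m = cos (y *+ 2) +i* sin (y *+ 2).
Proof.
have -> : omega R d = cos (pi / d%:R *+ 2) +i* sin (pi / d%:R *+ 2).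
  rewrite /omega -complexiE.
  have -> : 2 * pi%:C * 'i / d%:R = 0 +i* (pi / d%:R *+ 2) :> R[i].
    rewrite -!(rmorph_nat (real_complex R)) -fmorphV /= -[RHS]/(0 +i* _).
    by simpc; rewrite mulr_natl mulrnAl.
  by rewrite /cexp expR0 mul1r.
move=> y; have {y}-> : y *+ 2 = m%:R * (pi / d%:R *+ 2).
  by rewrite /y -mulrA mulrCA mulrnAr.
set theta := pi / _ *+ 2; move: theta => theta.
elim: m => [|m IHm]; first by rewrite mul0r cos0 sin0 expr0.
rewrite exprS IHm -natr1 mulrDl mul1r addrC cosD sinD; simpc.
by rewrite [sin _ * cos _ + _]addrC.
Qed.

Lemma omega_expd (R : realType) (d : nat) : (0 < d)%N -> omega R d ^+ d = 1.
Proof.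
move=> d_gt0; rewrite omegaX mulfK ?pnatr_eq0 -?lt0n // cos2pi.
by rewrite mulr2n sinDpi sinpi oppr0.
Qed.

Lemma omegaX_neq1 (R : realType) (d m : nat) :
  (0 < m < d)%N -> omega R d ^+ m != 1.
Proof.
case/andP=> m_gt0 m_lt; rewrite omegaX; set y := _ / _.
have d_gt0 : (0 : R) < d%:R by rewrite ltr0n (ltn_trans m_gt0 m_lt).
have y_gt0 : 0 < sin y.
  apply: sin_gt0_pi; apply/andP; split.
    by rewrite divr_gt0 // mulr_gt0 ?pi_gt0 // ltr0n.
  by rewrite ltr_pdivrMr // ltr_pM2l ?pi_gt0 // ltr_nat.
apply/eqP => -[/eqP + _].
(* By cos 2y = 1 - 2 sin^2 y, the value 1 would force sin y = 0. *)
rewrite cos_mulr2n cos2sin2 mulrnBl addrAC [1 *+ 2]mulr2n addrK.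
rewrite -subr_eq0 addrAC subrr add0r oppr_eq0 mulrn_eq0 /= expf_eq0 /=.
by rewrite gt_eqF.
Qed.

(** * The matrices of [calG] and their diagonal characters *)

Definition chi {R : realType} {d : nat} (p : 'I_d) (g : calG R d) : R[i] :=
  matG g p p.

Lemma clockMX (R : realType) (d j : nat) :
  clockM R d ^+ j = diag_mx (\row_p omega R d ^+ (p * j)).
Proof.
elim: j => [|j IHj].
  by apply/matrixP => p q; rewrite !mxE muln0.
rewrite exprS IHj [_ * _]mulmx_diag; congr diag_mx.
by apply/rowP => p; rewrite !mxE mulnS exprD.
Qed.

(** The exponent is left unbounded so that closure under products is immediate; M^d = I reduces it
    modulo [d]. *)
Lemma calGP (R : realType) (d : nat) (x : 'M[R[i]]_d) : (0 < d)%N ->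
  reflect (exists (b : bool) (j : nat), x = (-1) ^+ b * clockM R d ^+ j)
    (x \in calG_seq R d).
Proof.
move=> d_gt0; apply: (iffP idP).
  rewrite mem_cat => /orP[] /mapP[j _ ->].
    by exists false, j; rewrite mul1r.
  by exists true, j; rewrite mulN1r.
case=> b [j ->].
have clockMd : clockM R d ^+ d = 1.
  rewrite clockMX; apply/matrixP => p q.
  by rewrite !mxE mulnC exprM omega_expd // expr1n.
have -> : clockM R d ^+ j = clockM R d ^+ (j %% d).
  by rewrite {1}(divn_eq j d) exprD mulnC exprM clockMd expr1n mul1r.
have j_lt : (j %% d)%N \in iota 0 d by rewrite mem_iota ltn_mod.
rewrite mem_cat; case: b; rewrite ?mulN1r ?mul1r; apply/orP; [right | left].
  exact: (map_f (fun i => - clockM R d ^+ i)).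
exact: (map_f (fun i => clockM R d ^+ i)).
Qed.

Section Characters.
Context {R : realType} {d : nat}.

Lemma matG_form (d_gt0 : (0 < d)%N) (g : calG R d) :
  exists (b : bool) (j : nat),
    matG g = diag_mx (\row_p ((-1) ^+ b * omega R d ^+ (p * j))).
Proof.
have /(calGP _ _ _ d_gt0)[b [j gE]] := valP g.
exists b, j; rewrite /matG gE clockMX; apply/matrixP => p q.
by case: b {gE}; rewrite ?mulN1r ?mul1r !mxE ?mulN1r ?mul1r ?mulNrn.
Qed.

Lemma matG_diag (d_gt0 : (0 < d)%N) (g : calG R d) :
  matG g = diag_mx (\row_p chi p g).
Proof.
have [b [j gE]] := matG_form d_gt0 g; rewrite {1}gE; congr diag_mx.
by apply/rowP => p; rewrite !mxE /chi gE !mxE eqxx.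
Qed.

Lemma chi_neq0 (p : 'I_d) (g : calG R d) : chi p g != 0.
Proof.
have d_gt0 : (0 < d)%N by apply: leq_ltn_trans (ltn_ord p).
have [b [j gE]] := matG_form d_gt0 g.
rewrite /chi gE !mxE eqxx mulr1n mulf_neq0 ?signr_eq0 // expf_neq0 //.
apply/eqP => omega0; have /eqP := omega_expd R d d_gt0.
by rewrite omega0 expr0n gtn_eqF //= eq_sym oner_eq0.
Qed.

Lemma calG_mem (d_gt0 : (0 < d)%N) (b : bool) (j : nat) :
  exists g : calG R d, forall p, chi p g = (-1) ^+ b * omega R d ^+ (p * j).
Proof.
have mem : (-1) ^+ b * clockM R d ^+ j \in calG_seq R d.
  by apply/calGP => //; exists b, j.
exists (SeqSub mem) => p; rewrite /chi /matG /= clockMX.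
by case: b {mem}; rewrite ?mulN1r ?mul1r !mxE eqxx ?mulN1r ?mul1r.
Qed.

(** This is the twist for [sum_twisted_eq0]: multiplication by [g0], injective because the
    characters never vanish and together determine the matrix. *)
Lemma calG_translation (d_gt0 : (0 < d)%N) (g0 : calG R d) :
  exists2 tau : calG R d -> calG R d,
    injective tau & forall p g, chi p (tau g) = chi p g0 * chi p g.
Proof.
have memM g : matG g0 * matG g \in calG_seq R d.
  have /(calGP _ _ _ d_gt0)[b0 [j0 g0E]] := valP g0.
  have /(calGP _ _ _ d_gt0)[b [j gE]] := valP g.
  apply/calGP => //; exists (b0 (+) b), (j0 + j)%N.
  rewrite /matG g0E gE signr_addb exprD !mulrA; congr (_ * _).
  rewrite -!mulrA; congr (_ * _).
  by case: b {gE}; rewrite ?mulr1 ?mul1r ?mulrN1 ?mulN1r.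
pose tau g : calG R d := SeqSub (memM g).
have chiM p g : chi p (tau g) = chi p g0 * chi p g.
  rewrite {1}/chi -[matG _]/(matG g0 * matG g) !matG_diag //.
  by rewrite [_ * _]mulmx_diag !mxE eqxx.
exists tau => // g1 g2 eq_tau; apply/val_inj.
rewrite -[val g1]/(matG g1) -[val g2]/(matG g2) !matG_diag //.
congr diag_mx; apply/rowP => p; rewrite !mxE.
by apply: (mulfI (chi_neq0 p g0)); rewrite -!chiM eq_tau.
Qed.

Lemma chi_ord0_sqr (p : 'I_d) (g : calG R d) : p = 0%N :> nat ->
  chi p g * chi p g = 1.
Proof.
move=> p0; have d_gt0 : (0 < d)%N by apply: leq_ltn_trans (ltn_ord p).
have [b [j gE]] := matG_form d_gt0 g.
by rewrite /chi gE !mxE eqxx p0 mulr1n mul0n mulr1 -expr2 sqrr_sign.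
Qed.

(** M alone separates the characters: its diagonal entries [omega ^+ p], p < d, are distinct. *)
Lemma chi_inj (p q : 'I_d) :
  (forall g : calG R d, chi p g = chi q g) -> p = q.
Proof.
wlog le_pq : p q / (p <= q)%N => [hw|].
  by case: (leqP p q) => [|/ltnW] /hw // h eq_pq; apply/esym/h.
move=> eq_chi; apply/val_inj/eqP => /=; rewrite eqn_leq le_pq leqNgt.
apply/negP => lt_pq; have d_gt0 : (0 < d)%N by apply: leq_ltn_trans (ltn_ord p).
have [g gE] := calG_mem d_gt0 false 1; have := eq_chi g.
rewrite !gE !mul1r !muln1 -(subnKC le_pq) exprD -{1}[_ ^+ p]mulr1.
have om_neq0 : omega R d ^+ p != 0.
  by have := chi_neq0 p g; rewrite gE mul1r muln1.
move/(mulfI om_neq0)/esym/eqP; apply/negP/omegaX_neq1.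
by rewrite subn_gt0 lt_pq (leq_ltn_trans (leq_subr _ _)).
Qed.

Definition chi_same (p q : 'I_d) : bool :=
  [forall g : calG R d, chi p g == chi q g].

Definition chi_opp (p q : 'I_d) : bool :=
  [forall g : calG R d, chi p g * chi q g == 1].

(** [v0], [w0] stand for the values at a non-distinguished index, [v1], [w1] for those at the
    distinguished index of its vertex. *)
Definition factor_survives (V : eqType) (p q : 'I_d) (v0 v1 w0 w1 : V) : bool :=
  [|| (v0 == v1) && (w0 == w1),
      [&& v0 == w0, v1 == w1 & chi_opp p q]
    | [&& v0 == w1, v1 == w0 & chi_same p q]].

Lemma factor_survivesP (V : eqType) (p q : 'I_d) (v0 v1 w0 w1 : V)
    (H : V -> calG R d) :
  factor_survives V p q v0 v1 w0 w1 ->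
  chi p (H v0) / chi p (H v1) * (chi q (H w0) / chi q (H w1)) = 1.
Proof.
case/or3P=> [/andP[/eqP-> /eqP->]|/and3P[/eqP-> /eqP-> /forallP pq]
  |/and3P[/eqP-> /eqP-> /forallP pq]].
- by rewrite !divff ?chi_neq0 // mulr1.
- by rewrite mulrACA -invfM !(eqP (pq _)) invr1 mulr1.
- rewrite !(eqP (pq _)) mulrACA [_ * chi q (H w0)]mulrC -invfM.
  by rewrite divff // mulf_neq0 // chi_neq0.
Qed.

Lemma factor_mean (V I : finType) (m : nat) (h : I -> V -> calG R d)
    (p q : 'I_d) (v0 v1 w0 w1 : V) :
  uniform_values h -> wise_independent m h -> (0 < #|I|)%N -> (4 <= m)%N ->
  (\sum_c chi p (h c v0) / chi p (h c v1) * (chi q (h c w0) / chi q (h c w1)))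
    / #|I|%:R = (factor_survives V p q v0 v1 w0 w1)%:R.
Proof.
move=> hU hI I_gt0 m_ge4.
have [ok|notok] := boolP (factor_survives V p q v0 v1 w0 w1).
  under eq_bigr => c _ do rewrite factor_survivesP //.
  by rewrite sumr_const divff // pnatr_eq0 -lt0n.
have d_gt0 : (0 < d)%N by apply: leq_ltn_trans (ltn_ord p).
pose S := [set x in [:: v0; v1; w0; w1]].
have S_le : (#|S| <= m)%N.
  apply: leq_trans m_ge4; rewrite /S cardsE. exact: card_size.
have [v0S v1S w0S w1S] : [/\ v0 \in S, v1 \in S, w0 \in S & w1 \in S].
  by rewrite !inE !eqxx !orbT.
(* The four points may coincide, so [f x] gathers all characters evaluated at [x]. *)
pose f (x : V) (g : calG R d) : R[i] := (if x == v0 then chi p g else 1) *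
  (if x == v1 then (chi p g)^-1 else 1) *
  ((if x == w0 then chi q g else 1) *
  (if x == w1 then (chi q g)^-1 else 1)).
have -> : \sum_c chi p (h c v0) / chi p (h c v1) *
    (chi q (h c w0) / chi q (h c w1)) = \sum_c \prod_(x in S) f x (h c x).
  apply: eq_bigr => c _; rewrite !big_split /=.
  rewrite (prod_at _ _ S v0 (fun x => chi p (h c x))) //.
  rewrite (prod_at _ _ S v1 (fun x => (chi p (h c x))^-1)) //.
  rewrite (prod_at _ _ S w0 (fun x => chi q (h c x))) //.
  by rewrite (prod_at _ _ S w1 (fun x => (chi q (h c x))^-1)).
rewrite (wise_independent_mean _ m) //.
(* Were [f x] trivial at every point of [S], one of the surviving cases would be forced. *)
have [x xS [g0 fg0]] : exists2 x, x \in S & exists g0, f x g0 != 1.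
  have [/existsP[x /andP[xS /existsP[g0 ?]]]|/existsPn f1] :=
    boolP [exists x, (x \in S) && [exists g0, f x g0 != 1]].
    by exists x => //; exists g0.
  case/negP: notok.
  have {}f1 x g : x \in S -> f x g = 1.
    by move=> xS; have := f1 x; rewrite xS /= => /existsPn/(_ g)/negPn/eqP.
  (* gN = -I *)
  have [gN gNE] := calG_mem d_gt0 true 0.
  (* At -I, [f x] is -1 to the number of the four points equal to [x]. *)
  have parity x : x \in S ->
      (x == v0) (+) (x == v1) (+) ((x == w0) (+) (x == w1)) = false.
    move=> xS; have := f1 x gN xS.
    have sgn b : (if b then -1 else 1) = (-1) ^+ b :> R[i] by case: b.
    rewrite /f !gNE !muln0 !mulr1 expr1 invrN1 !sgn -!signr_addb => /eqP.
    by case: (_ (+) _) => //; rewrite expr1 eq_sym -addr_eq0 (pnatr_eq0 _ 2).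
  rewrite /factor_survives.
  have := parity v0 v0S; have := parity v1 v1S; have := parity w0 w0S.
  rewrite !eqxx ![v1 == v0]eq_sym ![w0 == v0]eq_sym ![w0 == v1]eq_sym.
  have [v01|v01] /= := eqVneq v0 v1.
    by rewrite v01; case: (v1 == w0); case: (w0 == w1).
  (* Parity at [v0] excludes [v0 = w1] and parity at [v1] gives [v1 = w1]; triviality of [f v0] is
     then [chi_opp]. The remaining case leads likewise to [chi_same]. *)
  have [vw0|vw0] /= := eqVneq v0 w0.
    case: (eqVneq v0 w1) => [//|vw1] /=.
    rewrite -vw0 [v1 == v0]eq_sym (negbTE v01) /=.
    case: (eqVneq v1 w1) => [vw11 _ _ _|//]; rewrite /= orbF.
    apply/forallP => g; have := f1 v0 g v0S.
    by rewrite /f -vw0 eqxx (negbTE v01) (negbTE vw1) !mulr1 => ->.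
  case: (eqVneq v0 w1) => [vw1|//] /=.
  rewrite -vw1 [v1 == v0]eq_sym (negbTE v01) /=.
  case: (eqVneq v1 w0) => [vw10 _ _ _|//] /=.
  apply/forallP => g; have /eqP := f1 v0 g v0S.
  rewrite /f -vw1 eqxx (negbTE v01) (negbTE vw0) !mulr1 mul1r.
  by rewrite -[1](divff (chi_neq0 q g)) => /eqP/(divIf (chi_neq0 q g))->.
(* [f x] is multiplicative, so translation by [g0] multiplies it by [f x g0], which is not 1. *)
rewrite (bigD1 x) //=; have [tau tau_inj tauE] := calG_translation d_gt0 g0.
rewrite (sum_twisted_eq0 _ _ (f x) tau (f x g0)) ?mul0r // => g.
have ifM (b : bool) (y z : R[i]) :
    (if b then y * z else 1) = (if b then y else 1) * (if b then z else 1).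
  by case: b; rewrite ?mulr1.
rewrite /f !tauE !invfM !ifM.
by rewrite [RHS]mulrACA; congr (_ * _); apply: mulrACA.
Qed.

End Characters.

(** * The expectation as a count of pairs of diagonal positions *)

Lemma calQ_diag (R : realType) (d t k : nat) (a : 'I_(2 * k) -> 'I_t)
    (dst : 'I_t -> 'I_(2 * k)) (V I : finType) (h : I -> V -> calG R d)
    (v : 'I_(2 * k) -> V) (s : outcome a dst I) :
  (0 < d)%N -> (forall b, a (dst b) = b) ->
  calQ h v s = diag_mx (\row_p \prod_(j : nondist a dst)
    (chi p (h (s j) (v (val j))) / chi p (h (s j) (v (dst (a (val j))))))).
Proof.
move=> d_gt0 a_dst.
pose X p i : R[i] := if insub i is Some j then chi p (h (s j) (v i))
  else \prod_(j : nondist a dst | val j \in Gamma a (a i))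
         (chi p (h (s j) (v i)))^-1.
have hashX_diag i : hashX h s i (v i) = diag_mx (\row_p X p i).
  rewrite /hashX /X; case: insub => [j|]; first exact: matG_diag.
  have inv_diag g :
      invmx (matG g) = diag_mx (\row_p (chi p g)^-1) :> 'M[R[i]]_d.
    rewrite matG_diag // invmx_diag => [|p]; last by rewrite mxE chi_neq0.
    by congr diag_mx; apply/rowP => p; rewrite !mxE.
  under eq_bigr => j _ do rewrite inv_diag.
  rewrite prod_diag_mx; congr diag_mx; apply/rowP => p; rewrite !mxE.
  by apply: eq_bigr => j _; rewrite mxE.
rewrite /calQ; under eq_bigr => i _ do rewrite hashX_diag.
rewrite prod_diag_mx; congr diag_mx; apply/rowP => p; rewrite !mxE.
under eq_bigr => i _ do rewrite mxE.
rewrite (bigID (fun i => i != dst (a i))) /= big_split /=; congr (_ * _).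
  rewrite (reindex_omap (val : nondist a dst -> _) insub) /=; last first.
    by move=> i nd; rewrite insubT.
  apply: eq_big => [j|j _]; last by rewrite /X valK.
  by rewrite valK eqxx (valP j).
pose Y (i : 'I_(2 * k)) (j : nondist a dst) := (chi p (h (s j) (v i)))^-1.
rewrite (eq_bigr (fun i => \prod_(j : nondist a dst | a (val j) == a i) Y i j));
  last first.
  move=> i /negPn di; rewrite /X insubN ?negbK //.
  by apply: eq_bigl => j; rewrite inE.
(* Exchanging the products hands each inverse factor at a distinguished index back to the [j] whose
   hash function it inverts. *)
rewrite (exchange_big_dep predT) //=; apply: eq_bigr => j _.
rewrite (big_pred1 (dst (a (val j)))) // => i /=; rewrite negbK.
apply/andP/eqP => [[/eqP-> /eqP->] //|->]; first by rewrite a_dst.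
by rewrite a_dst !eqxx.
Qed.

Definition survives {R : realType} {d t k : nat} {a : 'I_(2 * k) -> 'I_t}
    {dst : 'I_t -> 'I_(2 * k)} {V : finType} (v w : 'I_(2 * k) -> V)
    (p q : 'I_d) (j : nondist a dst) : bool :=
  factor_survives (R := R) V p q (v (val j)) (v (dst (a (val j))))
    (w (val j)) (w (dst (a (val j)))).

Lemma expectation_count (R : realType) (d t k m : nat)
    (a : 'I_(2 * k) -> 'I_t) (dst : 'I_t -> 'I_(2 * k)) (V I : finType)
    (h : I -> V -> calG R d) (v w : 'I_(2 * k) -> V) :
  (0 < d)%N -> (forall b, a (dst b) = b) ->
  uniform_values h -> wise_independent m h -> (0 < #|I|)%N -> (4 <= m)%N ->
  expectation (fun s : outcome a dst I => \tr (calQ h v s) * \tr (calQ h w s))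
  = \sum_(p < d) \sum_(q < d)
      [forall j : nondist a dst, survives (R := R) v w p q j]%:R.
Proof.
move=> d_gt0 a_dst hU hI I_gt0 m_ge4; rewrite /expectation.
pose F (p q : 'I_d) (j : nondist a dst) c : R[i] :=
  chi p (h c (v (val j))) / chi p (h c (v (dst (a (val j))))) *
  (chi q (h c (w (val j))) / chi q (h c (w (dst (a (val j)))))).
have trZ s : \tr (calQ h v s) * \tr (calQ h w s) =
    \sum_p \sum_q \prod_j F p q j (s j).
  rewrite !calQ_diag // !mxtrace_diag mulr_suml; apply: eq_bigr => p _.
  rewrite mulr_sumr; apply: eq_bigr => q _.
  by rewrite !mxE -big_split.
under eq_bigr => s _ do rewrite trZ.
rewrite exchange_big mulr_suml; apply: eq_bigr => p _.
rewrite exchange_big mulr_suml; apply: eq_bigr => q _ /=.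
(* Choices at different [j] are independent: the sum factors over [j], and the number of outcomes
   gives one divisor [#|I|] per factor. *)
rewrite -(bigA_distr_bigA (F p q)) card_ffun natrX -exprVn -prodr_const.
rewrite -big_split /=.
rewrite (eq_bigr (fun j => (survives (R := R) v w p q j)%:R)); last first.
  by move=> j _; rewrite (factor_mean V I m).
have [/forallP surv|/forallPn[j /negbTE dead]] :=
  boolP [forall j : nondist a dst, survives (R := R) v w p q j].
  by rewrite big1 // => j _; rewrite surv.
by rewrite (bigD1 j) //= dead mul0r.
Qed.

(** * Conditions 1 to 3 as comparisons with the distinguished index *)

Section Conditions.
Context {t k : nat} {a : 'I_(2 * k) -> 'I_t} {dst : 'I_t -> 'I_(2 * k)}.
Context {V : finType} {v w : 'I_(2 * k) -> V}.
Hypothesis a_dst : forall b, a (dst b) = b.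

Lemma nondist_ind (P : 'I_(2 * k) -> Prop) :
  (forall b, P (dst b)) -> (forall j : nondist a dst, P (val j)) ->
  forall i, P i.
Proof.
move=> P_dst P_nondist i; have [->//|di] := eqVneq i (dst (a i)).
exact: (P_nondist (Sub i di)).
Qed.

Definition same_pair (i : 'I_(2 * k)) : bool :=
  (v i == v (dst (a i))) && (w i == w (dst (a i))).

Definition matched_pair (i : 'I_(2 * k)) : bool :=
  [|| same_pair i, (v i == w i) && (v (dst (a i)) == w (dst (a i)))
    | (v i == w (dst (a i))) && (v (dst (a i)) == w i)].

Lemma condition1P :
  (forall b, condition1 a v w b) <->
  (forall j : nondist a dst, same_pair (val j)).
Proof.
split=> [c1 j|same b].
  have [cv cw] := c1 (a (val j)).
  by apply/andP; split; apply/eqP; [apply: cv | apply: cw];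
     rewrite inE ?a_dst.
have {same} sameb i : i \in Gamma a b -> v i = v (dst b) /\ w i = w (dst b).
  rewrite inE => /eqP <-; elim/nondist_ind: i => [b'|j]; first by rewrite a_dst.
  by have /andP[/eqP ? /eqP ?] := same j.
by split=> i j /sameb[vi wi] /sameb[vj wj]; rewrite ?vi ?vj ?wi ?wj.
Qed.

(** Indices at one vertex may match in different ways, but the values at [dst b] settle the
    condition: if they agree, every kind of match gives Condition 2; if not, only the kinds making
    up Condition 3 remain. *)
Lemma condition123P :
  (forall b, [\/ condition1 a v w b, condition2 a v w b
               | condition3 a v w b]) <->
  (forall j : nondist a dst, matched_pair (val j)).
Proof.
split=> [c123 j|matched b].
  have ij : val j \in Gamma a (a (val j)) by rewrite inE.
  have id : dst (a (val j)) \in Gamma a (a (val j)) by rewrite inE a_dst.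
  rewrite /matched_pair /same_pair.
  case: (c123 (a (val j))) => [[cv cw]|c2|[x [y c3]]].
  - by rewrite (cv _ _ ij id) (cw _ _ ij id) !eqxx.
  - by rewrite (c2 _ ij) (c2 _ id) !eqxx orbT.
  - by case: (c3 _ ij) (c3 _ id) => -[-> ->] [] [-> ->]; rewrite !eqxx ?orbT.
have {}matched i : matched_pair i.
  elim/nondist_ind: i => [b'|//].
  by rewrite /matched_pair /same_pair a_dst !eqxx.
have [vw|vw] := eqVneq (v (dst b)) (w (dst b)).
  apply: Or32 => i; rewrite inE => /eqP ai; have := matched i.
  rewrite /matched_pair /same_pair ai vw.
  by case/or3P=> /andP[/eqP vi /eqP wi]; rewrite ?vi ?wi.
apply: Or33; exists (v (dst b)), (w (dst b)) => i; rewrite inE => /eqP ai.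
have := matched i; rewrite /matched_pair /same_pair ai (negbTE vw) andbF /=.
by case/orP=> /andP[/eqP vi /eqP wi]; [left | right].
Qed.

Lemma survives_matched (R : realType) (d : nat) (p q : 'I_d)
    (j : nondist a dst) :
  survives (R := R) v w p q j -> matched_pair (val j).
Proof.
rewrite /matched_pair /same_pair.
by case/or3P=> [->//|/and3P[-> ->]|/and3P[-> ->]]; rewrite ?orbT.
Qed.

(** The character at position 0 takes only the values 1 and -1, so it is its own inverse and both
    character relations hold. *)
Lemma matched_survives (R : realType) (d : nat) (p : 'I_d)
    (j : nondist a dst) :
  p = 0%N :> nat -> matched_pair (val j) -> survives (R := R) v w p p j.
Proof.
move=> p0; rewrite /survives /factor_survives.
have -> : chi_opp (R := R) p p by apply/forallP => g; apply/eqP/chi_ord0_sqr.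
have -> : chi_same (R := R) p p by apply/forallP => g.
by rewrite !andbT.
Qed.

(** Either character relation with [p] determines [q]; if [q] and [q'] used different ones, all four
    values would coincide, against [notsame]. *)
Lemma survives_inj (R : realType) (d : nat) (p q q' : 'I_d)
    (j : nondist a dst) :
  ~~ same_pair (val j) -> survives (R := R) v w p q j ->
  survives (R := R) v w p q' j -> q = q'.
Proof.
rewrite /same_pair /survives /factor_survives => /negbTE notsame.
rewrite notsame /=.
case/orP=> /and3P[/eqP v0 /eqP v1 /forallP pq];
  case/orP=> /and3P[/eqP v0' /eqP v1' /forallP pq'].
- apply: (chi_inj (R := R)) => g; apply: (mulfI (chi_neq0 p g)).
  by rewrite (eqP (pq g)) (eqP (pq' g)).
- by move: notsame; rewrite v0' -v1 -v1' !eqxx.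
- by move: notsame; rewrite v0' -v1' v1 !eqxx.
- by apply: (chi_inj (R := R)) => g; rewrite -(eqP (pq g)) (eqP (pq' g)).
Qed.

End Conditions.

(** * The constant, positive and vanishing cases *)

Theorem theorem3p3 (R : realType) (d t k : nat)
    (eH : rel 'I_t) (a : 'I_(2 * k) -> 'I_t) (dst : 'I_t -> 'I_(2 * k))
    (V : finType) (eG : rel V) (I : finType) (h : I -> V -> calG R d)
    (v w : 'I_(2 * k) -> V)
    (d_ge2 : (2 <= d)%N)
    (simpleH : simple_graph eH)
    (connectedH : connected_graph eH)
    (no_leavesH : no_leaves eH)
    (orientationH : orientation eH a)
    (dstP : forall b : 'I_t, dst b \in Gamma a b)
    (simpleG : simple_graph eG)
    (uniform_h : uniform_values h)
    (independent_h : wise_independent (4 * k) h)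
    (edges_v : edge_tuple eG v)
    (edges_w : edge_tuple eG w) :
  let Z := fun s : outcome a dst I => \tr (calQ h v s) * \tr (calQ h w s) in
  let all1 := forall b : 'I_t, condition1 a v w b in
  let all123 := forall b : 'I_t,
    [\/ condition1 a v w b, condition2 a v w b | condition3 a v w b] in
  [/\ all1 -> forall s, Z s = d%:R ^+ 2,
      all123 /\ ~ all1 -> 0 < expectation Z /\ expectation Z <= d%:R
    & ~ all1 -> ~ (all123 /\ ~ all1) -> expectation Z = 0].
Proof.
move=> Z all1 all123.
have d_gt0 : (0 < d)%N by apply: ltnW.
have a_dst b : a (dst b) = b by have := dstP b; rewrite inE => /eqP.
have [t_gt0 _] := connectedH; have [b0 _] := card_gt0P t_gt0.
(* The index [dst b0] exists, so k > 0 and independence covers the four points of a factor. *)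
have k4 : (4 <= 4 * k)%N.
  have := leq_ltn_trans (leq0n _) (ltn_ord (dst b0)).
  by rewrite muln_gt0 => /leq_pmulr.
(* For an empty family, division by zero would make every probability 0, against the positive
   uniform value. *)
have I_gt0 : (0 < #|I|)%N.
  have [g _] := calG_mem (R := R) d_gt0 false 0.
  have := uniform_h (v (dst b0)) g; rewrite lt0n /unif_pr.
  apply: contra_eqN => /eqP ->; rewrite invr0 mulr0 mul1r eq_sym invr_eq0.
  by rewrite pnatr_eq0 -lt0n; apply/card_gt0P; exists g.
have EZ := expectation_count R d t k (4 * k) a dst V I h v w d_gt0 a_dst
  uniform_h independent_h I_gt0 k4.
split.
- move=> /(condition1P a_dst) same s.
  (* Under Condition 1 all quotients of characters are 1 for every outcome, so both matrices are the
     identity. *)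
  have tr1 (u : 'I_(2 * k) -> V) :
      (forall j : nondist a dst, u (val j) = u (dst (a (val j)))) ->
      \tr (calQ h u s) = d%:R.
    move=> u_same; rewrite calQ_diag // mxtrace_diag.
    rewrite (eq_bigr (fun=> 1)) ?sumr_const ?card_ord // => p _.
    by rewrite mxE big1 // => j _; rewrite u_same divff ?chi_neq0.
  by rewrite /Z !tr1 ?expr2 // => j; have /andP[/eqP ? /eqP ?] := same j.
- case=> /(condition123P a_dst) matched not1; rewrite /Z EZ.
  have [j notsame] : exists j : nondist a dst,
      ~~ same_pair (a := a) (dst := dst) (v := v) (w := w) (val j).
    apply/existsP; rewrite -negb_forall; apply/negP => /forallP same.
    exact/not1/(condition1P a_dst).
  (* The expectation is a natural number: the pair (0, 0) makes it positive, and [j] allows at most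
     one [q] for each [p]. *)
  under eq_bigr => p _ do rewrite -natr_sum.
  rewrite -natr_sum ltr0n ler_nat; split.
    pose p0 := Ordinal d_gt0.
    have surv : [forall i : nondist a dst, survives (R := R) v w p0 p0 i].
      by apply/forallP => i; apply: matched_survives.
    by rewrite (bigD1 p0) //= (bigD1 p0) //= surv.
  apply: leq_trans (_ : \sum_(p < d) 1 <= _)%N; last first.
    by rewrite sum1_card card_ord.
  apply: leq_sum => p _; rewrite -big_mkcond sum1_card.
  apply/card_le1_eqP => q q' /forallP/(_ j) qj /forallP/(_ j) q'j.
  exact: survives_inj notsame q'j qj.
- move=> not1 not123; rewrite /Z EZ big1 // => p _; rewrite big1 // => q _.
  (* A single surviving pair would already match every index. *)
  case: forallP => // surv; case: not123; split=> //.
  by apply/(condition123P a_dst) => j; apply: survives_matched (surv j).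
Qed.
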